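(* Let $k$ be a field, $n\in\mathbb{N}\setminus\{0\}$, and let $s=\sum_{g\in\mathbb{Z}^n}s_g\underline{x}^g\in k((\underline{x}))$. Suppose that there exist $\ell\in\mathbb{N}$, $A=\{h_0,\ldots,h_\ell\}\subseteq\mathbb{Z}^n$ with $h_0<_{\mathrm{lex}}\ldots<_{\mathrm{lex}}h_\ell$, and $r_0,\ldots,r_\ell\in k$, not all equal to $0$, such that for any $g\in\mathbb{Z}^n\setminus A$ $$\sum_{j=0}^\ell r_js_{g-h_j}=0.$$ Write $h_i=(h_{i1},\ldots,h_{in})$ for $i\in\{0,\ldots,\ell\}$ and let $\alpha=(\alpha_1,\ldots,\alpha_n)\in\mathbb{Z}^n$ with $\alpha_j=-\min\{h_{ij}\mid i\in\{0,\ldots,\ell\}\}$ for $j\in\{1,\ldots,n\}$. Set $$q=\sum_{i=0}^\ell r_i\underline{x}^{h_i+\alpha}\quad\text{and}\quad p=\sum_{i=0}^\ell\sum_{j=0}^\ell r_js_{h_i-h_j}\underline{x}^{h_i+\alpha}.$$ Then $p,q\in k[\underline{x}]$ and $s=\frac{p}{q}$.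
   Context: $\mathbb{N}$ includes $0$. $\mathbb{Z}^n$ is an ordered abelian group under the lexicographic ordering $<_{\mathrm{lex}}$. $k((\mathbb{Z}^n))$ is the field of generalised power series: all functions $s\colon\mathbb{Z}^n\to k$, written $s=\sum_{g}s_gt^g$, with well-ordered (for $<_{\mathrm{lex}}$) support $\{g\mid s_g\neq 0\}$, with pointwise addition and convolution product $sp=\sum_{g}\left(\sum_{h}s_hp_{g-h}\right)t^g$. Write $\underline{x}=(x_1,\ldots,x_n)$ and $\underline{x}^g=x_1^{g_1}\cdots x_n^{g_n}$. $k((\underline{x}))$ is the fraction field of the formal power series ring $k[[\underline{x}]]$. Since $\mathbb{N}^n$ is well-ordered by $<_{\mathrm{lex}}$, the map $\sum_{g\in\mathbb{N}^n}s_g\underline{x}^g\mapsto\sum_{g\in\mathbb{N}^n}s_gt^g$ embeds $k[[\underline{x}]]$ in $k((\mathbb{Z}^n))$; this extends to an embedding of $k((\underline{x}))$ in $k((\mathbb{Z}^n))$, and via it each element of $k((\underline{x}))$ is expanded uniquely as $\sum_{g\in\mathbb{Z}^n}s_g\underline{x}^g$, where $\sum_{g}s_gt^g$ is its image in $k((\mathbb{Z}^n))$. *)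

(* Defs.v *)
From HB Require Import structures.
From mathcomp Require Import all_boot all_order all_algebra.
From mathcomp Require Import mathcomp_extra boolp wochoice classical_sets.
From mathcomp Require Import functions cardinality fsbigop.
From mathcomp Require Import mpoly.

Set Implicit Arguments.
Unset Strict Implicit.
Unset Printing Implicit Defensive.

Import Order.TTheory GRing.Theory Num.Theory.
Local Open Scope ring_scope.

Section LexOrder.
Variable n : nat.
Local Notation G := 'rV[int]_n.
Implicit Types (g h x : G) (A B : {pred G}) (u : nat -> G).

Definition lextuple g : n.-tuplelexi int := [tuple g 0 j | j < n].

Definition lexle g h : bool := (lextuple g <= lextuple h)%O.
Definition lexlt g h : bool := (lextuple g < lextuple h)%O.

Lemma lextuple_inj : injective lextuple.
Proof.
move=> g h e; apply/rowP => j.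
by rewrite -(tnth_mktuple (g 0)) -(tnth_mktuple (h 0)) -/(lextuple g) e.
Qed.

Lemma lexltP g h : reflect
  (exists2 i : 'I_n, forall j : 'I_n, (j < i)%N -> g 0 j = h 0 j
                   & g 0 i < h 0 i) (lexlt g h).
Proof.
apply: (iffP ltxi_tuplePlt).
  by move=> [i]; rewrite !tnth_mktuple => eq lt; exists i => // j /eq;
     rewrite !tnth_mktuple.
by move=> [i eq lt]; exists i => [j /eq|]; rewrite !tnth_mktuple.
Qed.

Lemma lexlexx g : lexle g g. Proof. exact: lexx. Qed.
Lemma lexle_total g h : lexle g h || lexle h g. Proof. exact: le_total. Qed.
Lemma lexle_trans : transitive lexle.
Proof. by move=> h g x; apply: le_trans. Qed.
Lemma lexle_anti : antisymmetric lexle.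
Proof. by move=> g h /le_anti/lextuple_inj. Qed.
Lemma lexltNge g h : lexlt g h = ~~ lexle h g. Proof. exact: ltNge. Qed.
Lemma lexleNgt g h : lexle g h = ~~ lexlt h g. Proof. exact: leNgt. Qed.
Lemma lexltW g h : lexlt g h -> lexle g h. Proof. exact: ltW. Qed.
Lemma lexlt_trans : transitive lexlt.
Proof. by move=> h g x; apply: lt_trans. Qed.
Lemma lexle_lt_trans h g x : lexle g h -> lexlt h x -> lexlt g x.
Proof. exact: le_lt_trans. Qed.
Lemma lexlt_le_trans h g x : lexlt g h -> lexle h x -> lexlt g x.
Proof. exact: lt_le_trans. Qed.
Lemma lexltxx g : lexlt g g = false. Proof. exact: ltxx. Qed.
Lemma lexle_eqVlt g h : lexle g h = (g == h) || lexlt g h.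
Proof. by rewrite /lexle le_eqVlt (inj_eq lextuple_inj). Qed.

Lemma lexltD2r x g h : lexlt (g + x) (h + x) = lexlt g h.
Proof.
apply/lexltP/lexltP => -[i eq lt]; exists i.
- by move=> j /eq; rewrite !mxE => /addIr.
- by move: lt; rewrite !mxE ltrD2r.
- by move=> j /eq; rewrite !mxE => ->.
- by rewrite !mxE ltrD2r.
Qed.

Lemma lexleD2r x g h : lexle (g + x) (h + x) = lexle g h.
Proof. by rewrite !lexleNgt lexltD2r. Qed.

Lemma lexleD g h x y : lexle g h -> lexle x y -> lexle (g + x) (h + y).
Proof.
move=> gh xy; apply: (@lexle_trans (h + x)); first by rewrite lexleD2r.
by rewrite ![h + _]addrC lexleD2r.
Qed.

Lemma lexlt_leD g h x y : lexlt g h -> lexle x y -> lexlt (g + x) (h + y).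
Proof.
move=> gh xy; apply: (@lexlt_le_trans (h + x)); first by rewrite lexltD2r.
by rewrite ![h + _]addrC lexleD2r.
Qed.

Lemma lexleN g h : lexle (- g) (- h) = lexle h g.
Proof.
rewrite -(lexleD2r (g + h)) addrA addNr add0r.
by rewrite [g + h]addrC addrA addNr add0r.
Qed.

Lemma wo_min A B : wo_chain lexle A -> {subset B <= A} ->
  (exists x, x \in B) ->
  exists z, z \in B /\ forall x, x \in B -> lexle z x.
Proof.
by move=> woA sBA neB; have [z [[Bz zmin] _]] := woA B sBA neB; exists z.
Qed.

Lemma wo_chainP A : wo_chain lexle A <->
  (forall u, (forall i, u i \in A) -> exists i, lexle (u i) (u i.+1)).
Proof.
split=> [woA u uA|noA].
  pose B := [pred g | `[< exists i, g = u i >]].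
  have sBA : {subset B <= A} by move=> x /asboolP[i ->].
  have [|_ [/asboolP[i ->] min]] := wo_min woA sBA.
    by exists (u 0%N); apply/asboolP; exists 0%N.
  by exists i; apply: min; apply/asboolP; exists i.+1.
apply: antisymmetric_wo_chain => [g h _ _|B sBA [x0 Bx0]].
  exact: lexle_anti.
apply: contrapT => nomin.
have /choice[f fP] : forall x, exists y, x \in B -> y \in B /\ ~~ lexle x y.
  move=> x; have [Bx|] := boolP (x \in B); last by exists x.
  apply: contrapT => noy; apply: nomin; exists x; split=> // y By.
  by apply: contrapT => /negP nxy; apply: noy; exists y.
have uB i : iter i f x0 \in B by elim: i => //= i /fP[].
have [|i] := noA (fun i => iter i f x0).
  by move=> i; apply: sBA.
by apply/negP => /=; have [] := fP _ (uB i).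
Qed.

Lemma wo_subseq A u : wo_chain lexle A -> (forall i, u i \in A) ->
  exists phi : nat -> nat, {homo phi : i j / (i < j)%N} /\
    {homo u \o phi : i j / (i <= j)%N >-> lexle i j}.
Proof.
move=> woA uA.
have /choice[F FP] : forall N, exists m, (N <= m)%N /\
    forall j, (N <= j)%N -> lexle (u m) (u j).
  move=> N; pose B := [pred g | `[< exists i, (N <= i)%N /\ g = u i >]].
  have sBA : {subset B <= A} by move=> x /asboolP[i [_ ->]].
  have [|_ [/asboolP[i [Ni ->]] min]] := wo_min woA sBA.
    by exists (u N); apply/asboolP; exists N.
  by exists i; split=> // j Nj; apply: min; apply/asboolP; exists j.
pose phi i := iter i (fun m => F m.+1) (F 0%N).
have phi_lt : {homo phi : i j / (i < j)%N}.
  by apply: homo_ltn => [? ? ?|i]; [apply: ltn_trans | case: (FP (phi i).+1)].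
exists phi; split=> // i j; rewrite leq_eqVlt => /predU1P[->|/phi_lt lt_ij].
  exact: lexlexx.
case: i lt_ij => [|i] lt_ij; first by case: (FP 0%N) => _; apply.
case: (FP (phi i).+1) => _; apply; apply: leq_trans (ltnW lt_ij).
by case: (FP (phi i).+1).
Qed.

Lemma wo_sub A B : {subset B <= A} -> wo_chain lexle A -> wo_chain lexle B.
Proof. by move=> sBA /wo_chainP w; apply/wo_chainP => u uB; apply: w => i; apply: sBA. Qed.

Lemma wo_union A B : wo_chain lexle A -> wo_chain lexle B ->
  wo_chain lexle [predU A & B].
Proof.
move=> woA woB C sC [x0 Cx0].
suff [z [Cz zmin]] : exists z, minimum_of lexle C z.
  exists z; split=> // y [Cy ymin]; apply: lexle_anti.
  by rewrite zmin ?ymin.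
have sCAB x : x \in C -> (x \in A) || (x \in B).
  by move=> Cx; apply: sC.
have woC D E : wo_chain lexle D -> wo_chain lexle E ->
    (forall x, x \in C -> (x \in D) || (x \in E)) ->
    (exists x, x \in [predI C & D]) ->
    exists z, minimum_of lexle C z.
  move=> woD woE sCDE neD.
  have [|z [/andP[Cz Dz] zmin]] := wo_min woD _ neD; first by move=> x /andP[].
  have [[y Ey]|noE] := pselect (exists x, x \in [predI C & E]); last first.
    exists z; split=> // x Cx; apply: zmin; rewrite inE /= Cx.
    have /orP[//|Ex] := sCDE x Cx.
    by case: noE; exists x; rewrite inE /= Cx.
  have [|t [/andP[Ct Et] tmin]] := wo_min woE _ (ex_intro _ y Ey).
    by move=> x /andP[].
  have [zt|tz] := orP (lexle_total z t).
    exists z; split=> // x Cx; have /orP[Dx|Ex] := sCDE x Cx.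
      by apply: zmin; rewrite inE /= Cx.
    by apply: lexle_trans zt _; apply: tmin; rewrite inE /= Cx.
  exists t; split=> // x Cx; have /orP[Dx|Ex] := sCDE x Cx.
    by apply: lexle_trans tz _; apply: zmin; rewrite inE /= Cx.
  by apply: tmin; rewrite inE /= Cx.
have /orP[Ax|Bx] := sCAB _ Cx0.
  by apply: (woC A B) => //; exists x0; rewrite inE /= Cx0.
apply: (woC B A) => //; first by move=> x /sCAB; rewrite orbC.
by exists x0; rewrite inE /= Cx0.
Qed.

Definition sumpred A B : {pred G} :=
  [pred g | `[< exists a b, [/\ a \in A, b \in B & g = a + b] >]].

Lemma wo_sum A B : wo_chain lexle A -> wo_chain lexle B ->
  wo_chain lexle (sumpred A B).
Proof.
move=> woA woB; apply/wo_chainP => u uAB.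
have /choice[f fP] : forall i, exists ab : G * G,
    [/\ ab.1 \in A, ab.2 \in B & u i = ab.1 + ab.2].
  by move=> i; have /asboolP[a [b abP]] := uAB i; exists (a, b).
apply: contrapT => dec.
have ult : {homo u : i j / (i < j)%N >-> lexlt j i}.
  move=> i j; elim: j => // j IH; rewrite ltnS leq_eqVlt.
  have uj : lexlt (u j.+1) (u j).
    by rewrite lexltNge; apply/negP => uj; apply: dec; exists j.
  by move=> /predU1P[-> //|/IH]; apply: lexlt_trans.
have [phi [phi_lt amono]] := @wo_subseq A (fun i => (f i).1) woA
  (fun i => let: And3 P _ _ := fP i in P).
have [|i bi] := (wo_chainP B).1 woB (fun i => (f (phi i)).2).
  by move=> i; case: (fP (phi i)).
have := ult _ _ (phi_lt i i.+1 (ltnSn i)).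
rewrite lexltNge; case: (fP (phi i)) => _ _ ->; case: (fP (phi i.+1)) => _ _ ->.
by rewrite lexleD //; apply: (amono i i.+1).
Qed.

Lemma finite_fibre A B g : wo_chain lexle A -> wo_chain lexle B ->
  finite_set [set h | (h \in A) && (g - h \in B)].
Proof.
move=> woA woB; apply: contrapT => /infiniteP/card_leP[f].
pose u i : G := val (f (exist _ i (mem_set I))).
have uAB i : (u i \in A) && (g - u i \in B) by have /set_mem := valP (f (exist _ i (mem_set I))).
have uA i : u i \in A by have /andP[] := uAB i.
have uB i : g - u i \in B by have /andP[] := uAB i.
have uinj : injective u.
  move=> i j /val_inj fe; have := @inj _ _ _ f _ _ _ _ fe.
  by move=> /(_ (mem_set I) (mem_set I))[].
have [phi [phi_lt mono]] := wo_subseq woA uA.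
have [|i] := (wo_chainP B).1 woB (fun i => g - u (phi i)); first by [].
rewrite ![g - _]addrC lexleD2r lexleN => le1.
have eq : u (phi i) = u (phi i.+1).
  by apply: lexle_anti; rewrite le1 andbT; apply: (mono i i.+1).
by have := phi_lt i i.+1 (ltnSn i); rewrite (uinj _ _ eq) ltnn.
Qed.

Definition monoid_of A : {pred G} :=
  [pred g | `[< exists w : seq G, all (mem A) w /\ g = \sum_(x <- w) x >]].

Lemma monoid_of0 A : 0 \in monoid_of A.
Proof. by apply/asboolP; exists [::]; rewrite big_nil. Qed.

Lemma monoid_ofD A g h : g \in A -> h \in monoid_of A -> g + h \in monoid_of A.
Proof.
move=> Ag /asboolP[w [Aw ->]]; apply/asboolP; exists (g :: w).
by rewrite big_cons; split=> //=; apply/andP.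
Qed.

Lemma wo_monoid A : (forall g, g \in A -> lexlt 0 g) -> wo_chain lexle A ->
  wo_chain lexle (monoid_of A).
Proof.
move=> posA woA.
pose S (w : seq G) := \sum_(x <- w) x.
pose M := monoid_of A.
have posM g : g \in M -> lexle 0 g.
  move=> /asboolP[w [Aw ->]] {g}; elim: w Aw => [|x w IH] /=.
    by rewrite big_nil lexlexx.
  move=> /andP[/posA/lexltW px /IH pw]; rewrite big_cons.
  by have := lexleD px pw; rewrite addr0.
pose bad g := exists u, [/\ u 0%N = g, forall i, u i \in M &
  forall i, lexlt (u i.+1) (u i)].
suff nobad g : ~ bad g.
  apply/wo_chainP => u uM; apply: contrapT => dec; apply: (nobad (u 0%N)).
  exists u; split=> // i; rewrite lexltNge; apply/negP => ui.
  by apply: dec; exists i.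
move=> badg.
pose cand x w := [/\ all (mem A) w, bad (S w) & lexlt (S w) x].
have /choice[step stepP] : forall x, exists w, bad x -> cand x w /\
    forall v, cand x v -> (size w <= size v)%N.
  move=> x; have [[u [<- uM ult]]|] := pselect (bad x); last by exists [::].
  pose Q m := `[< exists w, cand (u 0%N) w /\ size w = m >].
  have exQ : exists m, Q m.
    have /asboolP[w [Aw u1]] := uM 1%N; exists (size w); apply/asboolP.
    exists w; split=> //; split=> //; last by rewrite /S -u1.
    by exists (fun i => u i.+1); split=> //.
  case: (ex_minnP exQ) => m /asboolP[w [cw <-]] wmin.
  by exists w => _; split=> // v cv; apply: wmin; apply/asboolP; exists v.
pose b i := iter i (fun x => S (step x)) g.
have badb i : bad (b i) by elim: i => //= i /stepP[[]].
have blt i : lexlt (b i.+1) (b i) by have [[]] := stepP _ (badb i).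
have bM i : b i \in M by have [u [<-]] := badb i.
have blt2 : {homo b : i j / (i < j)%N >-> lexlt j i}.
  move=> i j; elim: j => // j IH; rewrite ltnS leq_eqVlt.
  by move=> /predU1P[-> //|/IH]; apply: lexlt_trans.
have /choice[f fP] : forall i, exists xw : G * seq G, step (b i) = xw.1 :: xw.2.
  move=> i; case E: (step (b i)) => [|x w]; last by exists (x, w).
  have := blt i.+1; have := posM _ (bM i.+2).
  by rewrite [b i.+1]/b iterS -/(b i) E /S big_nil lexleNgt => /negbTE ->.
have Astep i : (f i).1 \in A /\ all (mem A) (f i).2.
  by have [[+ _ _] _] := stepP _ (badb i); rewrite fP => /andP[].
have bE i : b i.+1 = (f i).1 + S (f i).2.
  by rewrite [b i.+1]/b iterS -/(b i) fP /S big_cons.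
have [phi [phi_lt amono]] := @wo_subseq A (fun i => (f i).1) woA
  (fun i => (Astep i).1).
pose c i := S (f (phi i)).2.
have cE i : c i = b (phi i).+1 - (f (phi i)).1 by rewrite bE addrC addKr.
have badc : bad (c 0%N).
  exists c; split=> // i.
    by apply/asboolP; exists (f (phi i)).2; split=> //; case: (Astep (phi i)).
  rewrite !cE; apply: lexlt_leD; first by apply: blt2; apply: phi_lt.
  by rewrite lexleN; apply: (amono i i.+1).
have [_ stepmin] := stepP _ (badb (phi 0%N)).
suff /stepmin : cand (b (phi 0%N)) (f (phi 0%N)).2 by rewrite fP /= ltnn.
split=> //; first by case: (Astep (phi 0%N)).
apply: lexlt_trans (blt (phi 0%N)); rewrite bE -[X in lexlt X _]add0r.
by apply: lexlt_leD (lexlexx _); apply: posA; case: (Astep (phi 0%N)).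
Qed.

Lemma wo_shift A x : wo_chain lexle A -> wo_chain lexle [pred g | g - x \in A].
Proof.
move=> /wo_chainP woA; apply/wo_chainP => u uA.
by have [i] := woA (fun i => u i - x) uA; rewrite lexleD2r; exists i.
Qed.

Lemma wo_nonneg : wo_chain lexle [pred g : G | [forall j, 0 <= g 0 j]].
Proof.
apply/wo_chainP => u upos.
have posu i j : 0 <= u i 0 j by have /forallP := upos i.
suff: forall m, (m <= n)%N -> exists phi : nat -> nat,
    {homo phi : i j / (i < j)%N} /\ forall j : 'I_n, (j < m)%N ->
    forall a b, (a <= b)%N -> u (phi a) 0 j <= u (phi b) 0 j.
  move=> /(_ n (leqnn n))[phi [phi_lt mono]].
  apply: contrapT => dec.
  have ult : {homo u : i j / (i < j)%N >-> lexlt j i}.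
    move=> i j; elim: j => // j IH; rewrite ltnS leq_eqVlt.
    have uj : lexlt (u j.+1) (u j).
      by rewrite lexltNge; apply/negP => uj; apply: dec; exists j.
    by move=> /predU1P[-> //|/IH]; apply: lexlt_trans.
  have /lexltP[j _] := ult _ _ (phi_lt 0%N 1%N isT).
  by rewrite ltNge mono.
elim=> [_|m IH lt_mn]; first by exists id; split=> [i j|j].
have [phi [phi_lt mono]] := IH (ltnW lt_mn).
pose jm := Ordinal lt_mn; pose a i := absz (u (phi i) 0 jm).
have aE i : u (phi i) 0 jm = a i by rewrite /a gez0_abs.
have /choice[F FP] : forall N, exists i, (N <= i)%N /\
    forall j, (N <= j)%N -> (a i <= a j)%N.
  move=> N; have exQ : exists v, `[< exists i, (N <= i)%N /\ a i = v >].
    by exists (a N); apply/asboolP; exists N.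
  case: (ex_minnP exQ) => v /asboolP[i [Ni <-]] vmin; exists i; split=> // j Nj.
  by apply: vmin; apply/asboolP; exists j.
pose psi i := iter i (fun i => F i.+1) (F 0%N).
have psi_lt : {homo psi : i j / (i < j)%N}.
  by apply: homo_ltn => [? ? ?|i]; [apply: ltn_trans | case: (FP (psi i).+1)].
have psi_le : {homo psi : i j / (i <= j)%N}.
  by move=> i j; rewrite leq_eqVlt => /predU1P[-> //|/psi_lt/ltnW].
exists (phi \o psi); split=> [i j /psi_lt/phi_lt //|j].
rewrite ltnS leq_eqVlt => /orP[/eqP jE|ltj] i1 i2 le12; last first.
  by apply: mono => //; apply: psi_le.
have -> : j = jm by apply: val_inj.
rewrite /= !aE lez_nat.
move: le12; rewrite leq_eqVlt => /predU1P[-> //|/psi_lt lt12].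
case: i1 lt12 => [|i1] lt12; first by case: (FP 0%N) => _; apply.
case: (FP (psi i1).+1) => _; apply; apply: leq_trans (ltnW lt12).
by case: (FP (psi i1).+1).
Qed.

End LexOrder.

Section Hahn.
Variables (k : fieldType) (n : nat).
Local Notation G := 'rV[int]_n.

Record hahn := Hahn {
  hahn_coef :> G -> k;
  hahn_wo : wo_chain (@lexle n) [pred g | hahn_coef g != 0] }.

Arguments hahn_wo : clear implicits.

Lemma hahnP (s p : hahn) : s =1 p <-> s = p.
Proof.
split=> [|-> //]; case: s p => [s ws] [p wp] /= /funext e.
by case: _ / e wp => wp; congr Hahn; apply: Prop_irrelevance.
Qed.

HB.instance Definition _ := gen_eqMixin hahn.
HB.instance Definition _ := gen_choiceMixin hahn.

Definition conv (s p : G -> k) (g : G) : k :=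
  \sum_(h \in [set: G]) s h * p (g - h).

Lemma conv_widen (D : set G) (s p : G -> k) g :
  (forall h, s h != 0 -> p (g - h) != 0 -> D h) ->
  conv s p g = \sum_(h \in D) s h * p (g - h).
Proof.
move=> sD; apply/esym/fsbig_widen => // h [_ nDh] /=.
have [->|s0] := eqVneq (s h) 0; first by rewrite mul0r.
have [->|p0] := eqVneq (p (g - h)) 0; first by rewrite mulr0.
by case: nDh; apply: sD.
Qed.

Lemma conv_neq0 (s p : G -> k) g : conv s p g != 0 ->
  exists h, s h != 0 /\ p (g - h) != 0.
Proof.
move=> nz; apply: contrapT => noh; move/eqP: nz; apply.
rewrite (@conv_widen set0) ?fsbig_set0 // => h sh ph.
by apply: noh; exists h.
Qed.

Lemma convC s p : conv s p =1 conv p s.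
Proof.
move=> g; rewrite /conv (reindex_fsbigT (fun h => g - h)) /=; last first.
  by exists (fun h => g - h); apply: subKr.
by apply: eq_fsbigr => h _; rewrite subKr mulrC.
Qed.

Lemma conv1s p : conv (fun g => (g == 0)%:R) p =1 p.
Proof.
move=> g; rewrite (@conv_widen [set 0]) => [|h]; last first.
  by case: (h =P 0) => [-> //|_]; rewrite eqxx.
by rewrite fsbig_set1 eqxx subr0 mul1r.
Qed.

Lemma finite_conv (s p : hahn) g :
  finite_set [set h | (s h != 0) && (p (g - h) != 0)].
Proof.
have := finite_fibre g (hahn_wo s) (hahn_wo p).
apply: sub_finite_set => h /=.
by rewrite !inE.
Qed.

Lemma convDl (s p q : hahn) g :
  conv (fun h => s h + p h) q g = conv s q g + conv p q g.
Proof.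
pose D := ([set h | (s h != 0) && (q (g - h) != 0)] `|`
           [set h | (p h != 0) && (q (g - h) != 0)])%classic.
have Dfin : finite_set D by rewrite finite_setU; split; apply: finite_conv.
rewrite !(@conv_widen D); first last.
- move=> h spn qn; rewrite /D /= qn !andbT.
  by have [s0|] := eqVneq (s h) 0; [right; rewrite s0 add0r in spn | left].
- by move=> h sn qn; left; rewrite /= sn.
- by move=> h pn qn; right; rewrite /= pn.
rewrite -fsbig_split // -?fsbig_split //.
by apply: eq_fsbigr => h _; rewrite mulrDl.
Qed.

Lemma sumpred_conv (s p : hahn) g : conv s p g != 0 ->
  g \in sumpred [pred g | s g != 0] [pred g | p g != 0].
Proof.
move=> /conv_neq0[h [sh ph]]; apply/asboolP; exists h, (g - h); split=> //.
by rewrite addrC subrK.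
Qed.

Lemma convA (s p q : hahn) g : conv s (conv p q) g = conv (conv s p) q g.
Proof.
pose A : {pred G} := [pred g | s g != 0].
pose B : {pred G} := [pred g | p g != 0].
pose C : {pred G} := [pred g | q g != 0].
pose U := [set u : G | (u \in A) && (g - u \in sumpred B C)]%classic.
pose H := [set h : G | (h \in sumpred A B) && (g - h \in C)]%classic.
have Ufin : finite_set U.
  exact/finite_fibre/wo_sum/hahn_wo/hahn_wo/hahn_wo.
have Hfin : finite_set H.
  by apply: finite_fibre; [apply: wo_sum|]; apply: hahn_wo.
transitivity (\sum_(u \in U) \sum_(h \in H) s u * p (h - u) * q (g - h)).
  rewrite (@conv_widen U) => [|u su pu]; last first.
    by apply/andP; split; [apply: su | apply: sumpred_conv].
  apply: eq_fsbigr => u /set_mem /andP[su _].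
  rewrite /conv (reindex_fsbigT (fun h => h - u)) /=; last first.
    by exists (fun h => h + u) => h; rewrite ?subrK ?addrK.
  rewrite -(@fsbig_widen _ _ _ _ H) //=.
    rewrite mulr_fsumr; apply: eq_fsbigr => h _.
    by rewrite mulrA opprB addrA subrK.
  move=> h [_ nHh] /=; apply/eqP; apply: contra_notT nHh.
  rewrite mulf_eq0 negb_or opprB addrA subrK => /andP[ph qh].
  apply/andP; split; last exact: qh.
  apply/asboolP; exists u, (h - u).
  by split=> //; rewrite addrC subrK.
rewrite exchange_fsbig //; apply/esym.
rewrite (@conv_widen H) => [|h sph qh]; last first.
  by apply/andP; split; [apply: sumpred_conv | apply: qh].
apply: eq_fsbigr => h /set_mem /andP[_ qh].
rewrite (@conv_widen U) => [|u su ph]; first by rewrite mulr_fsuml.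
apply/andP; split; first exact: su.
apply/asboolP; exists (h - u), (g - h).
by split=> //; rewrite [RHS]addrC addrA subrK.
Qed.

Lemma hahn_wo_cst0 : wo_chain (@lexle n) [pred g : G | (0 : k) != 0].
Proof. by apply/wo_chainP => u /(_ 0%N); rewrite inE eqxx. Qed.

Lemma hahn_wo_delta (c : k) (x : G) :
  wo_chain (@lexle n) [pred g | c *+ (g == x) != 0].
Proof.
apply/wo_chainP => u ux.
have {}ux i : u i = x by have := ux i; rewrite inE; case: (u i =P x) => //; rewrite eqxx.
by exists 0%N; rewrite !ux lexlexx.
Qed.

Lemma hahn_woD (s p : hahn) : wo_chain (@lexle n) [pred g | s g + p g != 0].
Proof.
apply: wo_sub (wo_union (hahn_wo s) (hahn_wo p)) => g; rewrite !inE /=.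
by apply: contraNT; rewrite negb_or !negbK => /andP[/eqP-> /eqP->]; rewrite addr0.
Qed.

Lemma hahn_woN (s : hahn) : wo_chain (@lexle n) [pred g | - s g != 0].
Proof. by apply: wo_sub (hahn_wo s) => g; rewrite !inE oppr_eq0. Qed.

Lemma hahn_woM (s p : hahn) : wo_chain (@lexle n) [pred g | conv s p g != 0].
Proof.
by apply: wo_sub (wo_sum (hahn_wo s) (hahn_wo p)) => g; apply: sumpred_conv.
Qed.

Arguments hahn_wo_delta : clear implicits.
Arguments hahn_woD : clear implicits.
Arguments hahn_woN : clear implicits.
Arguments hahn_woM : clear implicits.
Arguments hahn_wo_cst0 : clear implicits.

Definition hahn_monom (c : k) (x : G) : hahn := Hahn (hahn_wo_delta c x).
Definition hahn0 : hahn := Hahn hahn_wo_cst0.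
Definition hahn1 : hahn := hahn_monom 1 0.
Definition hahn_add (s p : hahn) : hahn := Hahn (hahn_woD s p).
Definition hahn_opp (s : hahn) : hahn := Hahn (hahn_woN s).
Definition hahn_mul (s p : hahn) : hahn := Hahn (hahn_woM s p).

Fact hahn_addA : associative hahn_add.
Proof. by move=> s p q; apply/hahnP => g; apply: addrA. Qed.
Fact hahn_addC : commutative hahn_add.
Proof. by move=> s p; apply/hahnP => g; apply: addrC. Qed.
Fact hahn_add0 : left_id hahn0 hahn_add.
Proof. by move=> s; apply/hahnP => g; apply: add0r. Qed.
Fact hahn_addN : left_inverse hahn0 hahn_opp hahn_add.
Proof. by move=> s; apply/hahnP => g; apply: addNr. Qed.
HB.instance Definition _ :=
  GRing.isZmodule.Build hahn hahn_addA hahn_addC hahn_add0 hahn_addN.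

Fact hahn_mulA : associative hahn_mul.
Proof. by move=> s p q; apply/hahnP => g; apply: convA. Qed.
Fact hahn_mulC : commutative hahn_mul.
Proof. by move=> s p; apply/hahnP => g; apply: convC. Qed.
Fact hahn_mul1 : left_id hahn1 hahn_mul.
Proof. by move=> s; apply/hahnP => g; apply: conv1s. Qed.
Fact hahn_mulD : left_distributive hahn_mul hahn_add.
Proof. by move=> s p q; apply/hahnP => g; apply: convDl. Qed.
Fact hahn1_neq0 : hahn1 != 0.
Proof.
apply/eqP => /hahnP/(_ 0) /= /eqP.
by rewrite eqxx oner_eq0.
Qed.
HB.instance Definition _ := GRing.Zmodule_isComNzRing.Build hahn
  hahn_mulA hahn_mulC hahn_mul1 hahn_mulD hahn1_neq0.

Lemma hahn0E g : (0 : hahn) g = 0. Proof. by []. Qed.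
Lemma hahn1E g : (1 : hahn) g = (g == 0)%:R. Proof. by []. Qed.
Lemma hahnDE (s p : hahn) g : (s + p) g = s g + p g. Proof. by []. Qed.
Lemma hahnNE (s : hahn) g : (- s) g = - s g. Proof. by []. Qed.
Lemma hahnME (s p : hahn) g :
  (s * p) g = \sum_(h \in [set: G]) s h * p (g - h).
Proof. by []. Qed.
Lemma hahn_monomE c x g : hahn_monom c x g = c *+ (g == x). Proof. by []. Qed.

Lemma hahn_monomM c x (s : hahn) g : (hahn_monom c x * s) g = c * s (g - x).
Proof.
rewrite hahnME -/(conv _ _ _) (@conv_widen [set x]) => [|h]; last first.
  by rewrite hahn_monomE; case: (h =P x) => [-> //|_]; rewrite eqxx.
by rewrite fsbig_set1 hahn_monomE eqxx.
Qed.

Lemma hahn_geometric (e : hahn) : (forall g, e g != 0 -> lexlt 0 g) ->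
  exists y : hahn, y = 1 + e * y.
Proof.
move=> epos; pose E := [pred g | e g != 0]; pose M := monoid_of E.
have woM : wo_chain (@lexle n) M by apply: wo_monoid (hahn_wo e).
pose R a b := [&& a \in M, b \in M & lexlt a b].
have wfR : well_founded R.
  move=> b; apply: contrapT => nb.
  pose D := [pred g | (g \in M) && `[< ~ Acc R g >]].
  have [||z [/andP[Mz /asboolP nz] zmin]] := @wo_min _ M D woM.
  - by move=> x /andP[].
  - exists b; rewrite inE; have [Mb|nMb] := boolP (b \in M); first exact/asboolP.
    by case: nb; constructor => a /and3P[_ Mb]; rewrite Mb in nMb.
  apply: nz; constructor => a /and3P[Ma _]; rewrite lexltNge => az.
  apply: contrapT => na; move/negP: az; apply; apply: zmin.
  by rewrite inE Ma; apply/asboolP.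
pose body b (rec : forall a, R a b -> k) : k := if b \in M then
  (b == 0)%:R + \sum_(h \in [set: G])
    e h * (if pselect (R (b - h) b) is left r then rec _ r else 0) else 0.
pose y := Fix wfR (fun=> k) body.
have yE b : y b = if b \in M then (b == 0)%:R + \sum_(h \in [set: G])
    e h * (if R (b - h) b then y (b - h) else 0) else 0.
  rewrite /y Fix_eq -/y; last first.
    move=> x f g fg; rewrite /body; congr (if _ then _ + _ else _).
    by apply: eq_fsbigr => h _; case: pselect => // r; rewrite fg.
  rewrite /body; congr (if _ then _ + _ else _).
  apply: eq_fsbigr => h _; case: pselect => [->//|/negP/negbTE->//].
have y0 b : b \notin M -> y b = 0 by rewrite yE => /negbTE ->.
have woy : wo_chain (@lexle n) [pred g | y g != 0].
  by apply: wo_sub woM => g; rewrite inE; apply: contraNT => /y0->.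
exists (Hahn woy); apply/hahnP => b; rewrite hahnDE hahn1E hahnME /=.
have [Mb|nMb] := boolP (b \in M); last first.
  rewrite y0 // (_ : (b == 0) = false); last first.
    by apply: contraNF nMb => /eqP->; apply: monoid_of0.
  rewrite add0r fsbig1 // => h _; have [->|eh] := eqVneq (e h) 0.
    by rewrite mul0r.
  rewrite y0 ?mulr0 //; apply: contraNN nMb => Mbh.
  by rewrite -(subrK h b) addrC monoid_ofD.
rewrite yE Mb; congr (_ + _); apply: eq_fsbigr => h _.
have [->|eh] := eqVneq (e h) 0; first by rewrite !mul0r.
congr (_ * _); have [Mbh|nMbh] := boolP (b - h \in M); last first.
  by rewrite y0 // if_same.
rewrite /R Mbh Mb /= -[X in lexlt _ X](subrK h b).
by rewrite -[X in lexlt X _]add0r [b - h + h]addrC lexltD2r epos.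
Qed.

Lemma hahn_inv_ex (s : hahn) : exists p : hahn,
  if s == 0 then p = 0 else p * s = 1.
Proof.
have [_|s0] := eqVneq s 0; first by exists 0.
have neA : exists x, x \in [pred g | s g != 0].
  apply: contrapT => noA; move/eqP: s0; apply; apply/hahnP => g.
  by apply: contrapT => /eqP sg; apply: noA; exists g.
have [//|x [sx xmin]] := wo_min (hahn_wo s) _ neA.
rewrite inE in sx.
pose t := hahn_monom (s x)^-1 (- x).
have tsE g : (t * s) g = (s x)^-1 * s (g + x) by rewrite hahn_monomM opprK.
have [|y yE] := @hahn_geometric (1 - t * s).
  move=> g; rewrite hahnDE hahnNE hahn1E tsE => nz.
  have [g0|g0] := eqVneq g 0.
    by move: nz; rewrite g0 eqxx add0r mulVf // subrr eqxx.
  have : lexle 0 g.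
    rewrite -(lexleD2r x) add0r; apply: xmin; rewrite inE.
    apply: contraNN nz => /eqP->.
    by rewrite (negbTE g0) mulr0 subrr.
  by rewrite lexle_eqVlt eq_sym (negbTE g0).
exists (y * t); move: yE; rewrite mulrBl mul1r => yE.
rewrite -mulrA mulrC; apply: (@addIr _ (y - t * s * y)).
by rewrite -yE addrC subrK.
Qed.

Definition hahn_inv (s : hahn) : hahn := sval (cid (hahn_inv_ex s)).

Fact hahn_mulVf (s : hahn) : s != 0 -> hahn_inv s * s = 1.
Proof. by rewrite /hahn_inv; case: cid => p /=; case: eqP. Qed.
Fact hahn_inv0 : hahn_inv 0 = 0.
Proof. by rewrite /hahn_inv; case: cid => p /=; rewrite eqxx. Qed.
HB.instance Definition _ :=
  GRing.ComNzRing_isField.Build hahn hahn_mulVf hahn_inv0.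

End Hahn.

Arguments hahn_wo {k n} h.
Arguments hahn : clear implicits.

Section PowerSeries.
Variables (k : fieldType) (n : nat).
Local Notation G := 'rV[int]_n.
Local Notation hahn := (hahn k n).

Record mfps := Mfps { mfps_coef :> 'X_{1..n} -> k }.
Implicit Types (f g : mfps) (m : 'X_{1..n}).

Lemma mfpsP f g : f =1 g <-> f = g.
Proof. by split=> [|-> //]; case: f g => [f] [g] /= /funext ->. Qed.

HB.instance Definition _ := gen_eqMixin mfps.
HB.instance Definition _ := gen_choiceMixin mfps.

Definition mfps0 := Mfps (fun=> 0).
Definition mfps1 := Mfps (fun m => (m == 0%MM)%:R).
Definition mfps_add f g := Mfps (fun m => f m + g m).
Definition mfps_opp f := Mfps (fun m => - f m).
Definition mfps_mul f g := Mfps (fun m =>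
  \sum_(c : 'X_{1..n < (mdeg m).+1, (mdeg m).+1} | m == (c.1 + c.2)%MM)
    f c.1 * g c.2).

Fact mfps_addA : associative mfps_add.
Proof. by move=> f g h; apply/mfpsP => m; apply: addrA. Qed.
Fact mfps_addC : commutative mfps_add.
Proof. by move=> f g; apply/mfpsP => m; apply: addrC. Qed.
Fact mfps_add0 : left_id mfps0 mfps_add.
Proof. by move=> f; apply/mfpsP => m; apply: add0r. Qed.
Fact mfps_addN : left_inverse mfps0 mfps_opp mfps_add.
Proof. by move=> f; apply/mfpsP => m; apply: addNr. Qed.
HB.instance Definition _ :=
  GRing.isZmodule.Build mfps mfps_addA mfps_addC mfps_add0 mfps_addN.

Definition row_of_mnm m : G := \row_j (m j)%:Z.
Definition mnm_of_row (g : G) : 'X_{1..n} := [multinom absz (g 0%R j) | j < n].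

Lemma row_of_mnmK : cancel row_of_mnm mnm_of_row.
Proof. by move=> m; apply/mnmP => j; rewrite mnmE mxE. Qed.

Lemma mnm_of_rowK (x : G) :
  [forall j, 0 <= x 0 j] -> row_of_mnm (mnm_of_row x) = x.
Proof. by move=> /forallP x0; apply/rowP => j; rewrite !mxE mnmE gez0_abs. Qed.

Lemma row_of_mnm_ge0 m : [forall j, 0 <= row_of_mnm m 0 j].
Proof. by apply/forallP => j; rewrite mxE. Qed.

Lemma row_of_mnmD m1 m2 :
  row_of_mnm (m1 + m2)%MM = row_of_mnm m1 + row_of_mnm m2.
Proof. by apply/rowP => j; rewrite !mxE mnmDE PoszD. Qed.

Definition mfps_ext f (g : G) : k :=
  if [forall j, 0 <= g 0 j] then f (mnm_of_row g) else 0.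

Lemma mfps_ext_row f m : mfps_ext f (row_of_mnm m) = f m.
Proof. by rewrite /mfps_ext row_of_mnm_ge0 row_of_mnmK. Qed.

Lemma mfps_ext_wo f : wo_chain (@lexle n) [pred g | mfps_ext f g != 0].
Proof.
apply: wo_sub (@wo_nonneg n) => g; rewrite !inE /mfps_ext.
by case: ifP => //; rewrite eqxx.
Qed.

Definition mfps_hahn f : hahn := Hahn (@mfps_ext_wo f).

Lemma mfps_hahnE f (x : G) : mfps_hahn f x =
  if [forall j, 0 <= x 0 j] then f (mnm_of_row x) else 0.
Proof. by []. Qed.

Lemma mfps_hahn_inj : injective mfps_hahn.
Proof.
move=> f g /hahnP e; apply/mfpsP => m.
by have := e (row_of_mnm m); rewrite /= !mfps_ext_row.
Qed.

Lemma mfps_hahnD f g : mfps_hahn (f + g) = mfps_hahn f + mfps_hahn g.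
Proof.
apply/hahnP => x; rewrite hahnDE !mfps_hahnE.
by case: ifP => // _; rewrite addr0.
Qed.

Lemma mfps_hahn1 : mfps_hahn mfps1 = 1.
Proof.
apply/hahnP => x; rewrite mfps_hahnE hahn1E.
have -> : (0 : G) = row_of_mnm 0%MM by apply/rowP => j; rewrite !mxE mnm0E.
case: ifP => [/mnm_of_rowK e|x0]; last first.
  by case: eqP x0 => // ->; rewrite row_of_mnm_ge0.
by rewrite -{2}e (can_eq row_of_mnmK).
Qed.

Lemma mfps_hahnM f g : mfps_hahn (mfps_mul f g) = mfps_hahn f * mfps_hahn g.
Proof.
apply/hahnP => x; rewrite mfps_hahnE hahnME.
case: ifP => [/mnm_of_rowK e|x0]; last first.
  rewrite fsbig1 // => h _; rewrite !mfps_hahnE.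
  case: ifP => [/forallP h0|]; last by rewrite mul0r.
  case: ifP => [/forallP xh0|]; last by rewrite mulr0.
  move/forallP: x0; case => j.
  by have := addr_ge0 (xh0 j) (h0 j); rewrite !mxE subrK.
rewrite -[in RHS]e; move: (mnm_of_row x) => m {x e}.
set D := [set h : G | exists m1 m2, h = row_of_mnm m1 /\ m = (m1 + m2)%MM]%classic.
rewrite -/(conv _ _ _) (@conv_widen _ _ D) => [|h]; last first.
  rewrite !mfps_hahnE; case: ifP => [h0 _|]; last by rewrite eqxx.
  case: ifP => [mh0 _|]; last by rewrite eqxx.
  exists (mnm_of_row h), (mnm_of_row (row_of_mnm m - h)).
  rewrite mnm_of_rowK //; split=> //; apply: (can_inj row_of_mnmK).
  by rewrite row_of_mnmD !mnm_of_rowK // addrC subrK.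
pose I := 'X_{1..n < (mdeg m).+1, (mdeg m).+1}.
rewrite [LHS]/= (bigfs _ (index_enum_uniq I)); last first.
  by move=> c _; rewrite mem_index_enum.
rewrite (reindex_fsbig (fun c : I => row_of_mnm c.1)
  [set` (fun c : I => m == (c.1 + c.2)%MM)]%classic) /=.
  apply: eq_fsbigr => c; rewrite inE /= => /eqP mE.
  rewrite !mfps_ext_row; congr (_ * _).
  have -> : row_of_mnm m - row_of_mnm c.1 = row_of_mnm c.2.
    by rewrite (congr1 row_of_mnm mE) row_of_mnmD addrC addKr.
  by rewrite mfps_ext_row.
split.
- by move=> c /= /eqP mE; exists c.1, c.2.
- move=> [a1 a2] [b1 b2]; rewrite !inE /= => /eqP mE /eqP.
  rewrite {1}mE => ab /(can_inj row_of_mnmK) ab1; move: ab.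
  rewrite ab1 => /addmI ab2.
  by congr (_, _); apply: val_inj.
- move=> h [m1 [m2 [-> mE]]].
  have lt1 : (mdeg m1 < (mdeg m).+1)%N by rewrite mE mdegD ltnS leq_addr.
  have lt2 : (mdeg m2 < (mdeg m).+1)%N by rewrite mE mdegD ltnS leq_addl.
  by exists (BMultinom lt1, BMultinom lt2) => //=; apply/eqP.
Qed.

Fact mfps_mulA : associative mfps_mul.
Proof. by move=> f g h; apply: mfps_hahn_inj; rewrite !mfps_hahnM mulrA. Qed.
Fact mfps_mulC : commutative mfps_mul.
Proof. by move=> f g; apply: mfps_hahn_inj; rewrite !mfps_hahnM mulrC. Qed.
Fact mfps_mul1 : left_id mfps1 mfps_mul.
Proof.
by move=> f; apply: mfps_hahn_inj; rewrite mfps_hahnM mfps_hahn1 mul1r.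
Qed.
Fact mfps_mulD : left_distributive mfps_mul mfps_add.
Proof.
move=> f g h; apply: mfps_hahn_inj.
by rewrite mfps_hahnM !mfps_hahnD !mfps_hahnM mulrDl.
Qed.
Fact mfps1_neq0 : mfps1 != 0.
Proof. by apply/eqP => /mfpsP/(_ 0%MM)/eqP; rewrite /= eqxx oner_eq0. Qed.
HB.instance Definition _ := GRing.Zmodule_isComNzRing.Build mfps
  mfps_mulA mfps_mulC mfps_mul1 mfps_mulD mfps1_neq0.

Fact mfps_hahn_is_zmod_morphism : zmod_morphism mfps_hahn.
Proof.
move=> f g; apply/hahnP => x; rewrite hahnDE hahnNE !mfps_hahnE.
by case: ifP => // _; rewrite subr0.
Qed.
Fact mfps_hahn_is_monoid_morphism : monoid_morphism mfps_hahn.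
Proof. by split; [apply: mfps_hahn1 | apply: mfps_hahnM]. Qed.
HB.instance Definition _ := GRing.isZmodMorphism.Build mfps hahn mfps_hahn
  mfps_hahn_is_zmod_morphism.
HB.instance Definition _ := GRing.isMonoidMorphism.Build mfps hahn mfps_hahn
  mfps_hahn_is_monoid_morphism.

Definition mfps_unit : {pred mfps} := [pred f | `[< exists g, g * f = 1 >]].
Definition mfps_inv f : mfps := 
  if pselect (exists g, g * f = 1) is left e then sval (cid e) else f.

Fact mfps_mulVf : {in mfps_unit, left_inverse 1 mfps_inv *%R}.
Proof.
by move=> f /asboolP ef; rewrite /mfps_inv; case: pselect => // e; case: cid.
Qed.
Fact mfps_unitP f g : g * f = 1 -> f \in mfps_unit.
Proof. by move=> gf; apply/asboolP; exists g. Qed.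
Fact mfps_inv_out : {in [predC mfps_unit], mfps_inv =1 id}.
Proof.
by move=> f /asboolPn nf; rewrite /mfps_inv; case: pselect.
Qed.
HB.instance Definition _ := GRing.ComNzRing_hasMulInverse.Build mfps
  mfps_mulVf mfps_unitP mfps_inv_out.

Fact mfps_idomain : GRing.integral_domain_axiom mfps.
Proof.
move=> f g fg0; have /eqP := congr1 mfps_hahn fg0.
rewrite rmorphM rmorph0 mulf_eq0 -!(rmorph0 mfps_hahn).
by rewrite !(inj_eq mfps_hahn_inj).
Qed.
HB.instance Definition _ :=
  GRing.ComUnitRing_isIntegral.Build mfps mfps_idomain.

Definition mfps_of_mpoly (p : {mpoly k[n]}) : mfps := Mfps (fun m => p@_m).

Fact mfps_of_mpoly_is_zmod_morphism : zmod_morphism mfps_of_mpoly.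
Proof. by move=> p q; apply/mfpsP => m; apply: mcoeffB. Qed.
Fact mfps_of_mpoly_is_monoid_morphism : monoid_morphism mfps_of_mpoly.
Proof.
split=> [|p q]; apply/mfpsP => m; first by rewrite /= mcoeff1 eq_sym.
exact: mcoeffM.
Qed.
HB.instance Definition _ := GRing.isZmodMorphism.Build {mpoly k[n]} mfps
  mfps_of_mpoly mfps_of_mpoly_is_zmod_morphism.
HB.instance Definition _ := GRing.isMonoidMorphism.Build {mpoly k[n]} mfps
  mfps_of_mpoly mfps_of_mpoly_is_monoid_morphism.

End PowerSeries.

Arguments mfps : clear implicits.
Arguments mfps_hahn : simpl never.

Section Expansion.
Variables (k : fieldType) (n : nat).
Local Notation G := 'rV[int]_n.
Local Notation hahn := (hahn k n).
Local Notation mfps := (mfps k n).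
Local Notation kx := {fraction mfps}.
Local Notation tofrac := (@FracField.tofrac mfps).
Implicit Types (s : kx) (f d : mfps) (c : k) (g : G).

Definition expansion s : hahn :=
  mfps_hahn (\n_(repr s)) / mfps_hahn (\d_(repr s)).

Lemma frac_numden s : s = tofrac (\n_(repr s)) / tofrac (\d_(repr s)).
Proof.
apply: (canRL (mulfK _)); first by rewrite tofrac_eq0 denom_ratioP.
rewrite -{1}[s]reprK; move: (repr s) => r; unlock FracField.tofrac.
rewrite -[_ * _]FracField.pi_mul; apply/eqmodP.
rewrite /= FracField.equivfE /FracField.mulf /=.
by rewrite !numden_Ratio ?oner_neq0 ?mulf_neq0 ?denom_ratioP ?oner_neq0 //
   !mulr1 mulrC.
Qed.

Lemma mfps_hahn_eq0 f : (mfps_hahn f == 0) = (f == 0).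
Proof. by rewrite -(inj_eq (@mfps_hahn_inj k n)) rmorph0. Qed.

Lemma expansion_div f d : d != 0 ->
  expansion (tofrac f / tofrac d) = mfps_hahn f / mfps_hahn d.
Proof.
move=> d0; rewrite /expansion; set s := tofrac f / tofrac d.
have e0 : \d_(repr s) != 0 by apply: denom_ratioP.
apply/eqP; rewrite eqr_div ?mfps_hahn_eq0 // -!rmorphM.
rewrite (inj_eq (@mfps_hahn_inj k n)) -tofrac_eq !rmorphM.
by rewrite -eqr_div ?tofrac_eq0 // -frac_numden.
Qed.

Lemma expansion_tofrac f : expansion (tofrac f) = mfps_hahn f.
Proof. by have := expansion_div f (oner_neq0 _); rewrite !rmorph1 !divr1. Qed.

Fact expansion_is_zmod_morphism : zmod_morphism expansion.
Proof.
move=> s1 s2; rewrite [s1]frac_numden [s2]frac_numden.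
have := denom_ratioP (repr s1); have := denom_ratioP (repr s2).
move: (\n_ _) (\n_ _) (\d_ _) (\d_ _) => f1 f2 d2 d1 d20 d10.
rewrite !expansion_div // -!mulNr addf_div ?tofrac_eq0 //.
rewrite addf_div ?mfps_hahn_eq0 //.
rewrite -!rmorphN -!rmorphM -!rmorphD expansion_div ?mulf_neq0 //.
Qed.

Fact expansion_is_monoid_morphism : monoid_morphism expansion.
Proof.
split=> [|s1 s2]; first by rewrite -(rmorph1 tofrac) expansion_tofrac rmorph1.
rewrite [s1]frac_numden [s2]frac_numden.
have := denom_ratioP (repr s1); have := denom_ratioP (repr s2).
move: (\n_ _) (\n_ _) (\d_ _) (\d_ _) => f1 f2 d2 d1 d20 d10.
rewrite !expansion_div // mulf_div -!rmorphM expansion_div ?mulf_neq0 //.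
by rewrite !rmorphM mulf_div.
Qed.

HB.instance Definition _ := GRing.isZmodMorphism.Build kx hahn expansion
  expansion_is_zmod_morphism.
HB.instance Definition _ := GRing.isMonoidMorphism.Build kx hahn expansion
  expansion_is_monoid_morphism.

Definition polyfrac (p : {mpoly k[n]}) : kx := tofrac (mfps_of_mpoly p).
HB.instance Definition _ := GRing.RMorphism.copy polyfrac (tofrac \o @mfps_of_mpoly k n).

Definition xpow g : kx := \prod_(j < n) polyfrac 'X_j ^ g 0 j.

Definition is_poly s : Prop := exists p : {mpoly k[n]}, s = polyfrac p.

Lemma hahn_monomD (c d : k) (g h : G) :
  hahn_monom c g * hahn_monom d h = hahn_monom (c * d) (g + h).
Proof.
apply/hahnP => x; rewrite hahn_monomM !hahn_monomE.
by rewrite -mulrnAr subr_eq [h + g]addrC.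
Qed.

Lemma expansion_polyfracC c :
  expansion (polyfrac c%:MP) = hahn_monom c (0 : G).
Proof.
rewrite expansion_tofrac; apply/hahnP => x; rewrite mfps_hahnE hahn_monomE /=.
have -> : (0 : G) = row_of_mnm 0%MM by apply/rowP => j; rewrite !mxE mnm0E.
case: ifP => [/mnm_of_rowK e|x0]; last first.
  by case: eqP x0 => // ->; rewrite row_of_mnm_ge0.
by rewrite mcoeffC -{2}e (can_eq (@row_of_mnmK n)) mulr_natr eq_sym.
Qed.

Lemma expansion_polyfracX (j : 'I_n) :
  expansion (polyfrac 'X_j) = hahn_monom 1 (delta_mx 0 j : G).
Proof.
rewrite expansion_tofrac; apply/hahnP => x; rewrite mfps_hahnE hahn_monomE /=.
have -> : (delta_mx 0 j : G) = row_of_mnm U_(j)%MM.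
  by apply/rowP => i; rewrite !mxE mnm1E eqxx eq_sym; case: eqP.
case: ifP => [/mnm_of_rowK e|x0]; last first.
  by case: eqP x0 => // ->; rewrite row_of_mnm_ge0.
by rewrite mcoeffX -{2}e (can_eq (@row_of_mnmK n)) eq_sym.
Qed.

Lemma expansion_xpow g : expansion (xpow g) = hahn_monom 1 g.
Proof.
have monomX x (a : nat) :
    hahn_monom (1 : k) (x : G) ^+ a = hahn_monom 1 (x *+ a).
  elim: a => [|a IH]; first by rewrite mulr0n.
  by rewrite exprS IH hahn_monomD mulr1 mulrS.
have monomN x : (hahn_monom (1 : k) (x : G))^-1 = hahn_monom 1 (- x).
  by apply: mulr1_eq; rewrite hahn_monomD mulr1 subrr.
have monomZ x (a : int) :
    hahn_monom (1 : k) (x : G) ^ a = hahn_monom 1 (x *~ a).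
  case: a => a; first by rewrite -exprnP monomX -pmulrn.
  by rewrite NegzE -exprnN monomX monomN mulrNz -pmulrn.
have -> : g = \sum_j delta_mx 0 j *~ g 0 j.
  rewrite {1}[g]row_sum_delta; apply: eq_bigr => j _.
  by rewrite -scaler_int intz.
rewrite (big_morph (hahn_monom 1) (id1 := 1) (op1 := *%R)) //; last first.
  by move=> x y; rewrite hahn_monomD mulr1.
rewrite rmorph_prod; apply: eq_bigr => j _.
rewrite fmorphXz -monomZ -expansion_polyfracX; congr (_ ^ _).
rewrite summxE (bigD1 j) //= big1 => [|i ij].
  by rewrite -scaler_int !mxE !eqxx mulr1 addr0 intz.
by rewrite -scaler_int !mxE eqxx eq_sym (negbTE ij) mulr0.
Qed.

End Expansion.

Arguments expansion {k n} s : simpl never.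
Arguments polyfrac {k n} p : simpl never.
Arguments xpow k {n} g.

(* Main.v *)
(* Multiplication by q is the recurrence operator: the coefficient of s q at
   g + alpha is sum_j r_j s_{g - h_j}. The hypothesis kills it off the h_i, and on
   the h_i it is the coefficient of p by definition. Expansion is a ring morphism
   out of a field, hence injective, so s q = p already holds in the fraction field. *)
Require Import Defs.
From mathcomp Require Import all_boot all_order all_algebra.
From mathcomp Require Import mpoly.
Import Order.TTheory GRing.Theory Num.Theory.
Local Open Scope ring_scope.

Section Expansion.
Variables (k : fieldType) (n : nat).
Local Notation G := 'rV[int]_n.
Local Notation kx := {fraction (mfps k n)}.

Lemma hahn_sumE (I : finType) (F : I -> hahn k n) (g : G) :
  (\sum_i F i) g = \sum_i F i g.
Proof.
exact: (big_morph (fun f : hahn k n => f g) (fun s t => hahnDE s t g) (hahn0E k g)).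
Qed.

(** Turns [q] and [p] into finite sums of one-term series, whose product with [expansion s] is a
    mere shift. *)
Lemma expansion_term (c : k) (g : G) :
  expansion (polyfrac c%:MP * xpow k g) = hahn_monom c g.
Proof.
by rewrite rmorphM /= expansion_polyfracC expansion_xpow hahn_monomD mulr1 add0r.
Qed.

Lemma is_poly_sum (I : finType) (F : I -> kx) :
  (forall i, is_poly (F i)) -> is_poly (\sum_i F i).
Proof.
move=> polyF; apply: (big_ind (@is_poly k n)) => // [|_ _ [p ->] [q ->]].
  by exists 0; rewrite rmorph0.
by exists (p + q); rewrite rmorphD.
Qed.

(** Nonnegative exponents turn the integer powers in [xpow] into natural powers, which lift to
    [{mpoly k[n]}]. *)
Lemma is_poly_term (c : k) (g : G) :
  (forall j, 0 <= g 0 j) -> is_poly (polyfrac c%:MP * xpow k g).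
Proof.
move=> g0; exists (c%:MP * \prod_j 'X_j ^+ absz (g 0 j)).
rewrite rmorphM rmorph_prod; congr (_ * _); apply: eq_bigr => j _.
by rewrite rmorphXn exprnP gez0_abs.
Qed.

End Expansion.

Theorem mainTheorem6 (k : fieldType) (n : nat) (s : {fraction (mfps k n)})
    (l : nat) (h : 'I_l.+1 -> 'rV[int]_n) (r : 'I_l.+1 -> k) :
  (0 < n)%N ->
  (forall i j : 'I_l.+1, (i < j)%N -> lexlt (h i) (h j)) ->
  (exists j, r j != 0) ->
  (forall g : 'rV[int]_n, g \notin codom h ->
     \sum_(j < l.+1) r j * expansion s (g - h j) = 0) ->
  let alpha : 'rV[int]_n :=
    \row_(j < n) (- \big[Num.min/h ord0 0 j]_(i < l.+1) h i 0 j) in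
  let q := \sum_(i < l.+1) polyfrac (r i)%:MP * xpow k (h i + alpha) in
  let p := \sum_(i < l.+1) \sum_(j < l.+1)
    polyfrac (r j * expansion s (h i - h j))%:MP * xpow k (h i + alpha) in
  [/\ is_poly p, is_poly q, q != 0 & s = p / q].
Proof.
move=> _ h_lex [j0 rj0] rec alpha q p.
have h_inj : injective h.
  move=> i j hij; apply: val_inj; case: (ltngtP i j) => // /h_lex.
    by rewrite hij lexltxx.
  by rewrite hij lexltxx.
have ha_ge0 i j : 0 <= (h i + alpha) 0 j.
  by rewrite !mxE subr_ge0 bigmin_le_cond.
have qE : expansion q = \sum_i hahn_monom (r i) (h i + alpha).
  by rewrite rmorph_sum; apply: eq_bigr => i _; apply: expansion_term.
(* The exponents [h i + alpha] are pairwise distinct, so no terms merge; this reads off coefficients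
   of both [q] and [p]. *)
have coef_at (F : 'I_l.+1 -> k) i :
    \sum_j F j *+ (h i + alpha == h j + alpha) = F i.
  rewrite (bigD1 i) //= eqxx big1 ?addr0 // => j ji.
  by rewrite (inj_eq (addIr _)) (inj_eq h_inj) eq_sym (negbTE ji).
have q0 : q != 0.
  (* The coefficient of [expansion q] at [h j0 + alpha] is [r j0]. *)
  apply: contraNneq rj0 => q0; rewrite -(coef_at r j0).
  have := congr1 (fun f : hahn k n => f (h j0 + alpha)) qE.
  by rewrite q0 rmorph0 hahn0E hahn_sumE => /= <-.
split=> //.
- by apply: is_poly_sum => i; apply: is_poly_sum => j; apply: is_poly_term.
- by apply: is_poly_sum => i; apply: is_poly_term.
have pE : expansion p =
    \sum_i \sum_j hahn_monom (r j * expansion s (h i - h j)) (h i + alpha).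
  rewrite rmorph_sum; apply: eq_bigr => i _; rewrite rmorph_sum.
  by apply: eq_bigr => j _; apply: expansion_term.
suff sqE : expansion q * expansion s = expansion p.
  apply: (canRL (mulfK q0)); apply: (fmorph_inj expansion).
  by rewrite rmorphM mulrC.
apply/hahnP => g; rewrite pE qE mulr_suml !hahn_sumE.
(* Regroup [g - (h i + alpha)] as [(g - alpha) - h i], so that the left side is the recurrence sum
   at [g - alpha]. *)
under eq_bigr do rewrite hahn_monomM opprD [- _ - _]addrC addrA.
under [RHS]eq_bigr do
  (rewrite hahn_sumE; under eq_bigr do rewrite hahn_monomE; rewrite sumrMnl).
have [/codomP[i hi]|nh] := boolP (g - alpha \in codom h).
  by rewrite hi -[g](subrK alpha) hi coef_at.
(* Off the [h i] both sides vanish: the left by the recurrence, the right because no exponent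
   [h i + alpha] equals [g]. *)
rewrite rec // big1 // => i _; case: eqP => // gE.
by move: nh; rewrite gE addrK codom_f.
Qed.
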